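(* Let $([\underline{A};\overline{A}],O,B,U)$ be a PCS and let $L\in\mathbb{R}_{\ge0}^{k\times n}$ be a proper matrix. If $\operatorname{rs}(O)\subseteq\operatorname{rs}(L)$ and $L$ preserves the costs of the PCS, then $L$ is a constrained proper positive lumping of the PCS.
   Context: Notation. $\operatorname{rs}(L)$ is the row space of a matrix $L$. For $L\in\mathbb{R}^{k\times n}$ of rank $k\le n$, $L^+=L^T(LL^T)^{-1}$. The order $\le$ on matrices is component-wise, and $[\underline{A};\overline{A}]$ is the set of matrices $M$ with $\underline{A}\le M\le\overline{A}$. A function $A(\cdot)$ of time $t\ge 0$ is admissible if it is piecewise continuous with right limits and takes values in the prescribed set ($A(\cdot)\in[\underline{A};\overline{A}]$); similarly for $u(\cdot)\in U$ and $R(\cdot)\in[L\underline{A}L^+;L\overline{A}L^+]$. A matrix is Metzler if its off-diagonal entries are non-negative. PCS. A positive controlled system (PCS) $([\underline{A};\overline{A}],O,B,U)$ is given by $\partial_t x(t)=A(t)x(t)+Bu(t)$, $z(t)=Ox(t)$, where $O\in\mathbb{R}^{l\times n}$, $B\in\mathbb{R}_{\ge0}^{n\times m}$, $\underline{A},\overline{A}\in\mathbb{R}^{n\times n}$ are Metzler with $\underline{A}\le\overline{A}$, $U\subseteq\mathbb{R}_{\ge0}^m$ is compact and contains the origin, and $A(\cdot)\in[\underline{A};\overline{A}]$, $u(\cdot)\in U$ are admissible (both are controls). The initial condition is $x[0]\in\mathbb{R}_{\ge0}^n$, and $x^{(A,u)}$ is the corresponding solution. Lumpings. $L\in\mathbb{R}^{k\times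 n}$ of rank $k\le n$ is a constrained lumping of $A\in\mathbb{R}^{n\times n}$ with respect to $O$ if $\operatorname{rs}(O)\subseteq\operatorname{rs}(L)$ and $\operatorname{rs}(LA)\subseteq\operatorname{rs}(L)$. $L\in\mathbb{R}_{\ge0}^{k\times n}$ is proper if it has rank $k\le n$ and its rows have pairwise disjoint supports. $L$ is a constrained proper positive lumping of the PCS if $L\in\mathbb{R}_{\ge0}^{k\times n}$ is proper and is a constrained lumping of both $\underline{A}$ and $\overline{A}$ with respect to $O$. Reduced PCS. It is $([L\underline{A}L^+;L\overline{A}L^+],OL^+,LB,U)$ with initial condition $y[0]=Lx[0]$, i.e. $\partial_t y=R(t)y+LBu(t)$ with admissible $R(\cdot)\in[L\underline{A}L^+;L\overline{A}L^+]$ and $u(\cdot)\in U$. Costs. Given continuous $\Phi:\mathbb{R}^n\times\mathbb{R}^m\to\mathbb{R}$ (final cost) and $\Psi:\mathbb{R}\times\mathbb{R}^n\times\mathbb{R}^m\to\mathbb{R}$ (running cost), and $\tau\ge 0$, set $J_{(A,u)}(x[0],\tau)=\Phi(x^{(A,u)}(\tau),u(\tau))+\int_0^\tau\Psi(t,x^{(A,u)}(t),u(t))\,dt$, and let $V^{\inf}(x[0],\tau)$, $V^{\sup}(x[0],\tau)$ be the infimum and supremum of $J_{(A,u)}(x[0],\tau)$ over all admissible $A(\cdot)\in[\underline{A};\overline{A}]$ and $u(\cdot)\in U$. The costs are $L$-invariant if $\Phi(x,u)=\Phi(x',u)$ and $\Psi(t,x,u)=\Psi(t,x',u)$ whenever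 $Lx=Lx'$; then the reduced costs are $\hat\Phi(y,u)=\Phi(L^+y,u)$, $\hat\Psi(t,y,u)=\Psi(t,L^+y,u)$, and $\hat V^{\inf},\hat V^{\sup}$ are the corresponding values for the reduced PCS. $L$ preserves the costs of the PCS if for every $x[0]\in\mathbb{R}_{\ge0}^n$, with $y[0]=Lx[0]$, one has $V^{\inf}(x[0],\tau)=\hat V^{\inf}(y[0],\tau)$ and $V^{\sup}(x[0],\tau)=\hat V^{\sup}(y[0],\tau)$ for every $\tau\ge0$ and all $L$-invariant final and running costs $\Phi,\Psi$. *)

(* Defs.v *)
(* MathComp and MathComp-Analysis, over an arbitrary [R : realType]. *)
From HB Require Import structures.
From mathcomp Require Import all_boot all_order all_algebra.
From mathcomp Require Import all_classical all_reals all_analysis.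

Set Implicit Arguments.
Unset Strict Implicit.
Unset Printing Implicit Defensive.

Import Order.TTheory GRing.Theory Num.Theory.
Import numFieldNormedType.Exports.

Local Open Scope classical_set_scope.
Local Open Scope ring_scope.

Section Matrices.
Context {R : realType}.

Definition le_mx (p q : nat) (M N : 'M[R]_(p, q)) : Prop :=
  forall i j, M i j <= N i j.

Definition nonneg_mx (p q : nat) (M : 'M[R]_(p, q)) : Prop :=
  forall i j, 0 <= M i j.

Definition mx_itv (p q : nat) (lo hi : 'M[R]_(p, q)) : set 'M[R]_(p, q) :=
  [set M | le_mx lo M /\ le_mx M hi].

Definition metzler (n : nat) (A : 'M[R]_n) : Prop :=
  forall i j, i != j -> 0 <= A i j.

(* The inverse is a genuine one when [L] has full row rank. *)
Definition pinv (k n : nat) (L : 'M[R]_(k, n)) : 'M[R]_(n, k) :=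
  L^T *m invmx (L *m L^T).

Definition row_supp (k n : nat) (L : 'M[R]_(k, n)) (i : 'I_k) : set 'I_n :=
  [set j | L i j != 0].

(* [\rank L = k] entails [k <= n]. *)
Definition proper_mx (k n : nat) (L : 'M[R]_(k, n)) : Prop :=
  [/\ nonneg_mx L, \rank L = k &
      forall i i' : 'I_k, i != i' -> row_supp L i `&` row_supp L i' = set0].

Definition constrained_lumping (l k n : nat) (O : 'M[R]_(l, n))
    (A : 'M[R]_n) (L : 'M[R]_(k, n)) : Prop :=
  [/\ \rank L = k, (O <= L)%MS & (L *m A <= L)%MS].

End Matrices.

(* Raw data; the sign, order and topological requirements are in [is_pcs]. *)
Record pcs (R : realType) (l m n : nat) := Pcs {
  pcs_lo : 'M[R]_n;
  pcs_hi : 'M[R]_n;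
  pcs_out : 'M[R]_(l, n);
  pcs_in : 'M[R]_(n, m);
  pcs_ctrl : set 'cV[R]_m }.

Section ControlSystems.
Context {R : realType}.

Definition is_pcs (l m n : nat) (S : pcs R l m n) : Prop :=
  [/\ metzler (pcs_lo S), metzler (pcs_hi S) & le_mx (pcs_lo S) (pcs_hi S)] /\
  [/\ nonneg_mx (pcs_in S), pcs_ctrl S `<=` [set u | nonneg_mx u],
      compact (pcs_ctrl S) & pcs_ctrl S 0].

(* Functions of time are total on [R], but only their values at times [t >= 0]
   are constrained.  On every bounded interval there are finitely many
   discontinuities, and right limits exist at all times; neither left limits
   nor right continuity are required. *)
Definition piecewise_continuous (T : topologicalType) (f : R -> T) : Prop :=
  (forall b : R, exists s : seq R,
     forall t : R, 0 < t < b -> t \notin s -> {for t, continuous f}) /\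
  (forall t : R, 0 <= t -> exists l : T, f r @[r --> t^'+] --> l).

Definition admissible (T : topologicalType) (X : set T) (f : R -> T) : Prop :=
  piecewise_continuous f /\ (forall t : R, 0 <= t -> X (f t)).

(* For piecewise continuous controls, the differential equation is understood
   as usual: the trajectory is continuous, and differentiable (entry by entry)
   at all times where the right-hand side has no jump. *)
Definition is_solution (m n : nat) (A : R -> 'M[R]_n) (B : 'M[R]_(n, m))
    (u : R -> 'cV[R]_m) (x0 : 'cV[R]_n) (x : R -> 'cV[R]_n) : Prop :=
  [/\ x 0 = x0,
      {within [set t : R | 0 <= t], continuous x} &
      forall t : R, 0 < t ->
        {for t, continuous A} -> {for t, continuous u} ->
        forall i : 'I_n,
          is_derive t (1 : R) (fun s : R => x s i 0)
            ((A t *m x t + B *m u t) i 0)].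

Definition cost (m n : nat) (Phi : 'cV[R]_n * 'cV[R]_m -> R)
    (Psi : R * 'cV[R]_n * 'cV[R]_m -> R)
    (x : R -> 'cV[R]_n) (u : R -> 'cV[R]_m) (tau : R) : R :=
  Phi (x tau, u tau) +
  \int[lebesgue_measure]_(t in [set t : R | 0 <= t <= tau]) Psi (t, x t, u t).

Definition attainable_costs (l m n : nat) (S : pcs R l m n)
    (Phi : 'cV[R]_n * 'cV[R]_m -> R) (Psi : R * 'cV[R]_n * 'cV[R]_m -> R)
    (x0 : 'cV[R]_n) (tau : R) : set (\bar R) :=
  [set v | exists (A : R -> 'M[R]_n) (u : R -> 'cV[R]_m) (x : R -> 'cV[R]_n),
     [/\ admissible (mx_itv (pcs_lo S) (pcs_hi S)) A,
         admissible (pcs_ctrl S) u,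
         is_solution A (pcs_in S) u x0 x &
         v = (cost Phi Psi x u tau)%:E]].

Definition Vinf (l m n : nat) (S : pcs R l m n)
    (Phi : 'cV[R]_n * 'cV[R]_m -> R) (Psi : R * 'cV[R]_n * 'cV[R]_m -> R)
    (x0 : 'cV[R]_n) (tau : R) : \bar R :=
  ereal_inf (attainable_costs S Phi Psi x0 tau).

Definition Vsup (l m n : nat) (S : pcs R l m n)
    (Phi : 'cV[R]_n * 'cV[R]_m -> R) (Psi : R * 'cV[R]_n * 'cV[R]_m -> R)
    (x0 : 'cV[R]_n) (tau : R) : \bar R :=
  ereal_sup (attainable_costs S Phi Psi x0 tau).

Definition reduced_pcs (l m n k : nat) (L : 'M[R]_(k, n)) (S : pcs R l m n) :
    pcs R l m k :=
  {| pcs_lo := L *m pcs_lo S *m pinv L;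
     pcs_hi := L *m pcs_hi S *m pinv L;
     pcs_out := pcs_out S *m pinv L;
     pcs_in := L *m pcs_in S;
     pcs_ctrl := pcs_ctrl S |}.

Definition final_invariant (m n k : nat) (L : 'M[R]_(k, n))
    (Phi : 'cV[R]_n * 'cV[R]_m -> R) : Prop :=
  forall (x x' : 'cV[R]_n) (u : 'cV[R]_m),
    L *m x = L *m x' -> Phi (x, u) = Phi (x', u).

Definition running_invariant (m n k : nat) (L : 'M[R]_(k, n))
    (Psi : R * 'cV[R]_n * 'cV[R]_m -> R) : Prop :=
  forall (t : R) (x x' : 'cV[R]_n) (u : 'cV[R]_m),
    L *m x = L *m x' -> Psi (t, x, u) = Psi (t, x', u).

Definition reduced_final (m n k : nat) (L : 'M[R]_(k, n))
    (Phi : 'cV[R]_n * 'cV[R]_m -> R) : 'cV[R]_k * 'cV[R]_m -> R :=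
  fun yu => Phi (pinv L *m yu.1, yu.2).

Definition reduced_running (m n k : nat) (L : 'M[R]_(k, n))
    (Psi : R * 'cV[R]_n * 'cV[R]_m -> R) : R * 'cV[R]_k * 'cV[R]_m -> R :=
  fun tyu => Psi (tyu.1.1, pinv L *m tyu.1.2, tyu.2).

Definition preserves_costs (l m n k : nat) (L : 'M[R]_(k, n))
    (S : pcs R l m n) : Prop :=
  forall (x0 : 'cV[R]_n), nonneg_mx x0 ->
  forall (tau : R), 0 <= tau ->
  forall (Phi : 'cV[R]_n * 'cV[R]_m -> R) (Psi : R * 'cV[R]_n * 'cV[R]_m -> R),
    continuous Phi -> continuous Psi ->
    final_invariant L Phi -> running_invariant L Psi ->
    Vinf S Phi Psi x0 tau =
      Vinf (reduced_pcs L S) (reduced_final L Phi) (reduced_running L Psi)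
        (L *m x0) tau /\
    Vsup S Phi Psi x0 tau =
      Vsup (reduced_pcs L S) (reduced_final L Phi) (reduced_running L Psi)
        (L *m x0) tau.

Definition constrained_proper_positive_lumping (l m n k : nat)
    (L : 'M[R]_(k, n)) (S : pcs R l m n) : Prop :=
  [/\ proper_mx L,
      constrained_lumping (pcs_out S) (pcs_lo S) L &
      constrained_lumping (pcs_out S) (pcs_hi S) L].

End ControlSystems.

(* Main.v *)
Require Import Defs.
From mathcomp Require Import all_boot all_order all_algebra.
From mathcomp Require Import all_classical all_reals all_analysis.
From mathcomp Require Import lra ring.

(** The reduced system sees the initial state [x0] only through [L x0].  Cost
    preservation hence makes the values of the original system equal at any two
    nonnegative initial states with the same image under [L].

    Take as final cost the [r]-th entry of [L x], and no running cost.  Write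
    [w] for row [r] of [L], which is nonnegative.  For a nonnegative [x0] and a
    small time [T], the least cost is
      [w x0 + T w lo x0 + O (T^2 |x0| + T)],
    where [lo] is the lower bound of the interval of matrices: every trajectory
    satisfies the lower estimate since [w A x0 >= w lo x0]
    ([solution_expansion], through [Vinf_expansion]), and the trajectory
    [exp (T lo) x0] for the zero control attains it up to such an error
    ([flow_is_solution]).
    Likewise the greatest cost is [w x0 + T w hi x0 + O (T^2 |x0| + T)]
    ([Vsup_expansion]).

    Let [L v = 0], and let [p] be a nonnegative state with [p + v] nonnegative.
    The initial states [T^-1 p] and [T^-1 (p + v)] have the same image under
    [L], hence the same values, while the main terms of their expansions differ
    by [w lo v].  The errors are [O (T)], so [w lo v = 0]
    ([first_order_kernel]).  Scaling the states by [T^-1] is what makes the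
    influence of the control, of order [T], negligible against the main terms.
    As [r] varies, this says that the kernel of [L] is
    contained in that of [L lo], that is, the row space of [L lo] in that of
    [L] ([submx_of_ker]).  The same holds for [hi]. *)

Set Implicit Arguments.
Unset Strict Implicit.
Unset Printing Implicit Defensive.

Import Order.TTheory GRing.Theory Num.Theory.
Import numFieldNormedType.Exports.

Local Open Scope classical_set_scope.
Local Open Scope ring_scope.

(** * Estimates and calculus for matrices *)

Section MatrixNorm.
Context {R : realType}.

Lemma mx_entry_le_norm (p q : nat) (M : 'M[R]_(p, q)) i j : `|M i j| <= `|M|.
Proof.
rewrite -[leRHS]/(mx_norm M) mx_normrE.
by apply/bigmax_geP; right => /=; exists (i, j).
Qed.

Lemma mx_norm_le (p q : nat) (M : 'M[R]_(p, q)) (c : R) :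
  0 <= c -> (forall i j, `|M i j| <= c) -> `|M| <= c.
Proof.
move=> c0 Mc; rewrite -[leLHS]/(mx_norm M) mx_normrE.
by apply/bigmax_leP; split => // -[i j] _; exact: Mc.
Qed.

Lemma mx_norm_mul (p q r : nat) (A : 'M[R]_(p, q)) (B : 'M[R]_(q, r)) :
  `|A *m B| <= q%:R * (`|A| * `|B|).
Proof.
apply: mx_norm_le => [|i j]; first by rewrite !mulr_ge0.
rewrite mxE (le_trans (ler_norm_sum _ _ _))//.
rewrite mulr_natl -[X in _ *+ X]card_ord -sumr_const; apply: ler_sum => l _.
by rewrite normrM ler_pM// mx_entry_le_norm.
Qed.

Lemma mx_itv_norm (p q : nat) (lo hi M : 'M[R]_(p, q)) :
  mx_itv lo hi M -> `|M| <= `|lo| + `|hi|.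
Proof.
move=> [loM Mhi]; apply: mx_norm_le => [|i j]; first by rewrite addr_ge0.
have := loM i j; have := Mhi i j.
have := mx_entry_le_norm lo i j; have := mx_entry_le_norm hi i j.
rewrite !ler_norml; lra.
Qed.

Lemma ler_mulmx_nneg (p q r : nat) (A : 'M[R]_(p, q)) (B C : 'M[R]_(q, r)) :
  nonneg_mx A -> le_mx B C -> le_mx (A *m B) (A *m C).
Proof. by move=> A0 BC i j; rewrite !mxE ler_sum// => l _; rewrite ler_wpM2l. Qed.

Lemma ler_mulmx_nnegr (p q r : nat) (A B : 'M[R]_(p, q)) (C : 'M[R]_(q, r)) :
  nonneg_mx C -> le_mx A B -> le_mx (A *m C) (B *m C).
Proof. by move=> C0 AB i j; rewrite !mxE ler_sum// => l _; rewrite ler_wpM2r. Qed.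

Lemma mulmxB_entry (p q r : nat) (w : 'M[R]_(p, q)) (x y : 'M[R]_(q, r)) i j :
  (w *m (x - y)) i j = (w *m x) i j - (w *m y) i j.
Proof. by rewrite mulmxBr mxE [X in _ + X]mxE. Qed.

Lemma mulmx_continuous (p q r : nat) (w : 'M[R]_(p, q)) i j :
  continuous (fun x : 'M[R]_(q, r) => (w *m x) i j).
Proof.
rewrite (_ : (fun y : 'M[R]_(q, r) => (w *m y) i j) =
             (fun y => \sum_l w i l * y l j)); last first.
  by apply/funext => y; rewrite mxE.
apply: continuous_big => [|l _ x]; first exact: add_continuous.
exact: cvgMl_tmp (@coord_continuous R q r l j x).
Qed.

Lemma mulmx_is_derive (p q : nat) (w : 'M[R]_(p, q)) i (x : R -> 'cV[R]_q)
    (dx : 'cV[R]_q) (t : R) :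
  (forall l, is_derive t (1 : R) (fun s => x s l 0) (dx l 0)) ->
  is_derive t (1 : R) (fun s => (w *m x s) i 0) ((w *m dx) i 0).
Proof.
move=> dxE; rewrite mxE.
rewrite (_ : (fun s => (w *m x s) i 0) =
             \sum_l (w i l \*: (fun s => x s l 0))); last first.
  by apply/funext => s; rewrite mxE fct_sumE.
by apply: is_derive_sum => l; exact: is_deriveZ.
Qed.

Lemma col_continuous (q : nat) (T : topologicalType) (x : T -> 'cV[R]_q) :
  (forall l, continuous (fun s => x s l 0)) -> continuous x.
Proof.
move=> cx; rewrite (_ : x = fun s => \sum_l x s l 0 *: delta_mx l 0); last first.
  apply/funext => s; rewrite {1}[x s]matrix_sum_delta.
  by under eq_bigr do rewrite big_ord1.
apply: continuous_big => [|l _ t]; first exact: add_continuous.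
by apply: cvgZr_tmp; exact: cx.
Qed.

End MatrixNorm.

(** * Mean value inequalities *)

Section MeanValue.
Context {R : realType}.

(** An interval is cut at each exceptional point that it contains; the
    inequalities on the two pieces add up. *)
Lemma mean_value_le_except (g : R -> R) (c : R) (s : seq R) (a b : R) :
  a <= b -> {within `[a, b], continuous g} ->
  (forall t, a < t < b -> t \notin s ->
     exists2 d, is_derive t (1 : R) g d & d <= c) ->
  g b - g a <= c * (b - a).
Proof.
elim: s a b => [|e s IHs] a b ab cg dg.
  have [->|neq_ab] := eqVneq a b; first by rewrite !subrr mulr0.
  have {}ab : a < b by rewrite lt_neqAle neq_ab ab.
  have dg' t : t \in `]a, b[ -> is_derive t (1 : R) g ('D_1 g t).
    rewrite in_itv/= => /dg -/(_ isT) [d gd _].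
    exact: DeriveDef.
  have [t tab ->] := MVT ab dg' cg.
  rewrite ler_wpM2r ?subr_ge0 ?(ltW ab)//.
  move: tab; rewrite in_itv/= => /dg -/(_ isT) [d gd].
  by rewrite derive_val.
have sub u v : a <= u -> u <= v -> v <= b ->
    (forall t, u < t < v -> t != e) -> g v - g u <= c * (v - u).
  move=> au uv vb ne; apply: IHs => // [|t uvt ts].
    apply: continuous_subspaceW cg => z /=; rewrite !in_itv/= => /andP[uz zv].
    by rewrite (le_trans au uz) (le_trans zv vb).
  apply: dg; last by rewrite inE negb_or ne.
  by case/andP: uvt => ut tv; rewrite (le_lt_trans au ut) (lt_le_trans tv vb).
have [/andP[ae eb]|nabe] := boolP (a < e < b).
  have -> : g b - g a = (g e - g a) + (g b - g e) by ring.
  have -> : c * (b - a) = c * (e - a) + c * (b - e) by ring.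
  rewrite lerD// sub ?lexx ?ltW// => t /andP[t1 t2]; first by rewrite lt_eqF.
  by rewrite gt_eqF.
by apply: sub => // t abt; apply: contraNneq nabe => <-.
Qed.

Lemma within_itv_comp (T U : topologicalType) (x : R -> T) (f : T -> U) (b : R) :
  {within [set t : R | 0 <= t], continuous x} -> continuous f ->
  {within `[0, b], continuous (fun t => f (x t))}.
Proof.
move=> cx cf; apply: (@continuous_subspaceW _ _ `[0, b] [set t : R | 0 <= t]).
  by move=> t /=; rewrite in_itv/= => /andP[].
by move=> t; apply: continuous_comp; [exact: cx|exact: cf].
Qed.

(** Trajectories are only required to satisfy the differential equation away
    from the jumps of the controls, which are finite in number before [T]. *)
Lemma solution_mean_value (m n : nat) (A : R -> 'M[R]_n) (B : 'M[R]_(n, m))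
    (u : R -> 'cV[R]_m) (x0 : 'cV[R]_n) (x : R -> 'cV[R]_n) (w : 'rV[R]_n)
    (c T : R) :
  piecewise_continuous A -> piecewise_continuous u ->
  is_solution A B u x0 x -> 0 <= T ->
  (forall t, 0 < t < T -> (w *m (A t *m x t + B *m u t)) 0 0 <= c) ->
  (w *m (x T - x0)) 0 0 <= c * T.
Proof.
move=> [/(_ T)[sA cA] _] [/(_ T)[su cu] _] [x_0 cx dx] T0 wc.
have := @mean_value_le_except (fun t => (w *m x t) 0 0) c (sA ++ su) 0 T T0.
rewrite x_0 subr0 mulmxB_entry; apply.
  exact: (within_itv_comp (f := fun y : 'cV[R]_n => (w *m y) 0 0) cx
    (@mulmx_continuous R _ _ _ w 0 0)).
move=> t t0T; rewrite mem_cat negb_or => /andP[tA tu].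
exists ((w *m (A t *m x t + B *m u t)) 0 0); last exact: wc.
apply: mulmx_is_derive => l; case/andP: (t0T) => t0 _.
by apply: dx => //; [apply: cA|apply: cu].
Qed.

Lemma piecewise_continuous_cst (T : topologicalType) (X : T) :
  piecewise_continuous (fun _ : R => X).
Proof.
by split=> [b|t _]; [exists [::] => t _ _|exists X]; exact: cvg_cst.
Qed.
End MeanValue.

(** * Trajectories at short times *)

Section ShortTime.
Context {R : realType} (m n : nat).
Variables (lo hi : 'M[R]_n) (B : 'M[R]_(n, m)) (K beta : R).
Variables (A : R -> 'M[R]_n) (u : R -> 'cV[R]_m).
Variables (x0 : 'cV[R]_n) (x : R -> 'cV[R]_n) (T : R).
Hypothesis pcA : piecewise_continuous A.
Hypothesis pcu : piecewise_continuous u.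
Hypothesis xsol : is_solution A B u x0 x.
Hypothesis Aitv : forall t, 0 <= t -> mx_itv lo hi (A t).
Hypothesis KA : forall t, 0 <= t -> forall q (y : 'M[R]_(n, q)), `|A t *m y| <= K * `|y|.
Hypothesis Bu : forall t, 0 <= t -> `|B *m u t| <= beta.
Hypothesis K0 : 0 <= K.
Hypothesis T0 : 0 <= T.
Hypothesis TK : T * K <= 2^-1.

(** A self-bounding estimate for [T * K <= 1/2]: if the displacement is
    maximal over times up to [T] at [s], with value [D], the speed before [s] is at
    most [K (|x0| + D) + beta], so [D <= T (K (|x0| + D) + beta)], and half of
    [D] absorbs the term in [D] on the right. *)
Lemma solution_displacement :
  exists2 D : R, D <= 2 * T * (K * `|x0| + beta) &
    forall t, 0 <= t <= T -> `|x t - x0| <= D.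
Proof.
have [_ cx _] := xsol.
have cN : {within `[0, T], continuous (fun t => `|x t - x0|)}.
  apply: (@within_itv_comp _ _ _ _ (fun y : 'cV[R]_n => `|y - x0|) _ cx).
  move=> y; have cB : (fun z : 'cV[R]_n => z - x0) @ y --> y - x0.
    exact: (@cvgB _ _ _ (nbhs y) _ _ _ _ _ cvg_id (cvg_cst x0)).
  exact: (cvg_norm cB).
have [s s0T sM] := EVT_max T0 cN.
have {}sM t : 0 <= t <= T -> `|x t - x0| <= `|x s - x0|.
  by move=> t0T; apply: sM; rewrite in_itv.
move: s0T; rewrite in_itv/= => /andP[s0 sT].
set D := `|x s - x0| in sM; exists D => //.
have D0 : 0 <= D by rewrite normr_ge0.
have b0 : 0 <= beta by apply: le_trans (Bu (lexx 0)).
have speed t : 0 < t < s -> `|A t *m x t + B *m u t| <= K * (`|x0| + D) + beta.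
  case/andP=> t0 ts; rewrite (le_trans (ler_normD _ _))// lerD ?Bu ?(ltW t0)//.
  rewrite (le_trans (KA (ltW t0) _))// ler_wpM2l//.
  rewrite -[x t](subrK x0) addrC (le_trans (ler_normD _ _))// lerD2l sM//.
  by rewrite (ltW t0) (le_trans (ltW ts) sT).
have Ds : D <= (K * (`|x0| + D) + beta) * s.
  have c0 : 0 <= K * (`|x0| + D) + beta by rewrite addr_ge0 ?mulr_ge0 ?addr_ge0.
  apply: mx_norm_le => [|i j]; first by rewrite mulr_ge0.
  rewrite [j]ord1 ler_norml -lerNl.
  have coord (w : 'rV[R]_n) : (forall M : 'cV[R]_n, (w *m M) 0 0 <= `|M|) ->
      (w *m (x s - x0)) 0 0 <= (K * (`|x0| + D) + beta) * s.
    move=> wM; apply: (solution_mean_value pcA pcu xsol s0) => t t0s.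
    exact: le_trans (wM _) (speed t t0s).
  apply/andP; split.
    have := coord (- delta_mx 0 i); rewrite mulNmx -rowE !mxE; apply=> M.
    by rewrite mulNmx -rowE !mxE (le_trans (ler_norm _))// normrN mx_entry_le_norm.
  have := coord (delta_mx 0 i); rewrite -rowE !mxE; apply=> M.
  by rewrite -rowE !mxE (le_trans (ler_norm _))// mx_entry_le_norm.
have Ds' : D <= (K * (`|x0| + D) + beta) * T.
  by rewrite (le_trans Ds)// ler_wpM2l// addr_ge0 ?mulr_ge0 ?addr_ge0.
have : T * K * D <= 2^-1 * D by rewrite ler_wpM2r.
by move: Ds'; rewrite -/D; lra.
Qed.

(** The derivative of [w *m x] is [w *m A t *m x0], which lies between the values
    at [lo] and [hi] because [w] and [x0] are nonnegative, up to an error of at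
    most [n |w| (K D + beta)], where [D] is the bound on the displacement. *)
Lemma solution_expansion (w : 'rV[R]_n) :
  nonneg_mx w -> nonneg_mx x0 ->
  let E := 2 * n%:R * `|w| * T * (T * K ^+ 2 * `|x0| + beta) in
  (w *m x0) 0 0 + T * (w *m lo *m x0) 0 0 - E <= (w *m x T) 0 0 /\
  (w *m x T) 0 0 <= (w *m x0) 0 0 + T * (w *m hi *m x0) 0 0 + E.
Proof.
move=> w0 x00 E.
have [D DT xD] := solution_displacement.
set F := n%:R * (`|w| * (K * D + beta)).
have FE : F * T <= E.
  have b0 : 0 <= beta by apply: le_trans (Bu (lexx 0)).
  have KD : K * D + beta <= 2 * T * K ^+ 2 * `|x0| + 2 * beta.
    have h1 := ler_wpM2l K0 DT.
    have h2 := ler_wpM2r b0 TK; nra.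
  have h3 : F <= n%:R * (`|w| * (2 * T * K ^+ 2 * `|x0| + 2 * beta)).
    by rewrite !ler_wpM2l.
  have := ler_wpM2r T0 h3; rewrite /E; lra.
have rem t : 0 < t < T -> `|w *m (A t *m (x t - x0) + B *m u t)| <= F.
  case/andP=> t0 tT; rewrite (le_trans (mx_norm_mul _ _))// !ler_wpM2l//.
  rewrite (le_trans (ler_normD _ _))// lerD ?Bu ?(ltW t0)//.
  by rewrite (le_trans (KA (ltW t0) _))// ler_wpM2l// xD// !ltW.
have split t : w *m (A t *m x t + B *m u t) =
    w *m A t *m x0 + w *m (A t *m (x t - x0) + B *m u t).
  by rewrite -[w *m A t *m x0]mulmxA -mulmxDr addrA -mulmxDr [x0 + _]addrC subrK.
have entry (M : 'M[R]_1) : `|M| <= F -> - F <= M 0 0 <= F.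
  by move=> MF; rewrite -ler_norml (le_trans (mx_entry_le_norm _ _ _)).
have up : (w *m (x T - x0)) 0 0 <= ((w *m hi *m x0) 0 0 + F) * T.
  apply: (solution_mean_value pcA pcu xsol T0) => t t0T; rewrite split mxE.
  have /entry/andP[_ ?] := rem t t0T; rewrite lerD//.
  apply: ler_mulmx_nnegr => //; apply: ler_mulmx_nneg => //.
  by case/andP: t0T => /ltW/Aitv[].
have dn : ((- w) *m (x T - x0)) 0 0 <= (- (w *m lo *m x0) 0 0 + F) * T.
  apply: (solution_mean_value pcA pcu xsol T0) => t t0T.
  rewrite mulNmx split mxE [X in - X]mxE opprD.
  have /entry/andP[? _] := rem t t0T.
  apply: lerD; [rewrite lerN2|by rewrite lerNl].
  apply: ler_mulmx_nnegr => //; apply: ler_mulmx_nneg => //.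
  by case/andP: t0T => /ltW/Aitv[].
move: up dn; rewrite !mulmxB_entry !mulNmx [(- (w *m x T)) 0 0]mxE [(- (w *m x0)) 0 0]mxE.
by move=> up dn; split; lra.
Qed.

End ShortTime.

(** * Trajectories of a constant linear system *)

Section LinearFlow.
Context {R : realType} (n : nat).
Variable A : 'M[R]_n.

Definition flow_coef (y : 'cV[R]_n) (j : 'I_n) (k : nat) : R :=
  iter k (mulmx A) y j 0 / k`!%:R.

(** The matrix exponential [exp (t A)] applied to [y], entry by entry. *)
Definition flow (y : 'cV[R]_n) (t : R) : 'cV[R]_n :=
  \col_j limn (pseries (flow_coef y j) t).

Lemma iter_mulmx_norm (y : 'cV[R]_n) k :
  `|iter k (mulmx A) y| <= (n%:R * `|A|) ^+ k * `|y|.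
Proof.
elim: k => [|k IHk]; first by rewrite expr0 mul1r.
rewrite iterS (le_trans (mx_norm_mul _ _))// [leLHS]mulrA exprS -[leRHS]mulrA.
by rewrite ler_wpM2l// ?mulr_ge0.
Qed.

Lemma flow_coef_cvg (y : 'cV[R]_n) j t : cvgn (pseries (flow_coef y j) t).
Proof.
apply: normed_cvg.
apply: (@series_le_cvg _ _
  (fun k => `|y| * exp_coeff (n%:R * `|A| * `|t|) k)) => [k|k|k|].
- exact: normr_ge0.
- by rewrite mulr_ge0// exp_coeff_ge0// !mulr_ge0.
- have -> : `|y| * exp_coeff (n%:R * `|A| * `|t|) k =
      (n%:R * `|A|) ^+ k * `|y| / k`!%:R * `|t| ^+ k.
    by rewrite /exp_coeff /= exprMn; ring.
  rewrite /flow_coef /= !normrM normfV normr_nat normrX.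
  rewrite ler_wpM2r ?exprn_ge0// ler_wpM2r ?invr_ge0//.
  exact: le_trans (mx_entry_le_norm _ _ _) (iter_mulmx_norm _ _).
- exact/is_cvg_seriesZ/is_cvg_series_exp_coeff.
Qed.

(** Differentiating the series of [exp (t A) y] term by term gives the series
    of [exp (t A) (A y)], which is therefore convergent for the same reason. *)
Lemma flow_coef_diffs (y : 'cV[R]_n) j :
  pseries_diffs (flow_coef y j) = flow_coef (A *m y) j.
Proof.
apply/funext => k; rewrite /pseries_diffs /flow_coef -iterSr factS natrM invfM.
by rewrite mulrCA mulVKf.
Qed.

Lemma flow_mul (y : 'cV[R]_n) t : flow (A *m y) t = A *m flow y t.
Proof.
apply/colP => i; rewrite !mxE; apply: cvg_lim => //.
rewrite (_ : pseries _ t =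
    fun N => \sum_j A i j * pseries (flow_coef y j) t N); last first.
  apply/funext => N; rewrite /pseries /series /=.
  under [RHS]eq_bigr do rewrite mulr_sumr.
  rewrite exchange_big /=; apply: eq_bigr => k _.
  rewrite /flow_coef -iterSr iterS mxE !mulr_suml; apply: eq_bigr => j _.
  by rewrite !mulrA.
apply: cvg_big => [|j _]; first exact: add_continuous.
by rewrite mxE; apply: cvgMl_tmp; exact: flow_coef_cvg.
Qed.

Lemma flow_is_derive (y : 'cV[R]_n) t i :
  is_derive t (1 : R) (fun s => flow y s i 0) ((A *m flow y t) i 0).
Proof.
rewrite -flow_mul mxE -flow_coef_diffs.
rewrite (_ : (fun s => _) = fun s => limn (pseries (flow_coef y i) s)); last first.
  by apply/funext => s; rewrite mxE.
apply: (@pseries_snd_diffs _ _ (`|t| + 1)); rewrite ?flow_coef_diffs;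
  [exact: flow_coef_cvg..|].
by rewrite [ltRHS]ger0_norm ?ltrDl// addr_ge0.
Qed.

Lemma flow0 (y : 'cV[R]_n) : flow y 0 = y.
Proof.
apply/colP => i; rewrite mxE; apply: lim_near_cst => //.
near=> N; rewrite -[N]prednK; last by near: N.
rewrite /pseries /series /= big_nat_recl//= big1 ?addr0 => [|k _].
  by rewrite /flow_coef fact0 divr1 expr0 mulr1.
by rewrite expr0n mulr0.
Unshelve. all: by end_near. Qed.

Lemma flow_is_solution (m : nat) (B : 'M[R]_(n, m)) (y : 'cV[R]_n) :
  is_solution (fun=> A) B (fun=> 0) y (flow y).
Proof.
split; first exact: flow0.
  apply: continuous_subspaceT; apply: col_continuous => l t.
  have [/derivable1_diffP/differentiable_continuous dl _] := flow_is_derive y t l.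
  exact: dl.
by move=> t _ _ _ i; rewrite mulmx0 addr0; exact: flow_is_derive.
Qed.

End LinearFlow.

(** * First-order expansion of the values *)

Section Values.
Context {R : realType}.

(** The error has a part quadratic in [T], proportional to the initial state,
    and a part linear in [T] that does not depend on it: the latter comes from
    the control [u], and is negligible against the first-order term only for
    large initial states. *)
Definition first_order_expansion (n : nat) (V : 'cV[R]_n -> R -> \bar R)
    (w : 'rV[R]_n) (M : 'M[R]_n) : Prop :=
  exists K P Q : R, 0 <= K /\
  forall x0 : 'cV[R]_n, nonneg_mx x0 -> forall T, 0 <= T -> T * K <= 2^-1 ->
    let a := (w *m x0) 0 0 + T * (w *m M *m x0) 0 0 in
    let e := T * (P * T * `|x0| + Q) in
    ((a - e)%:E <= V x0 T /\ V x0 T <= (a + e)%:E)%E.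

(** [V] does not distinguish [T^-1 *: (p + v)] from [T^-1 *: p], whose
    expansions at time [T] differ by [w *m M *m v].  Both errors are at most a
    constant times [T], because the initial states are of order [T^-1]; they
    vanish as [T] tends to [0]. *)
Lemma first_order_kernel (k n : nat) (L : 'M[R]_(k, n))
    (V : 'cV[R]_n -> R -> \bar R) (w : 'rV[R]_n) (M : 'M[R]_n) (v : 'cV[R]_n) :
  first_order_expansion V w M ->
  (forall x0 x0', nonneg_mx x0 -> nonneg_mx x0' -> L *m x0 = L *m x0' ->
     forall T, 0 <= T -> V x0 T = V x0' T) ->
  L *m v = 0 -> w *m v = 0 -> (w *m M *m v) 0 0 = 0.
Proof.
move=> [K [P [Q [K0 VE]]]] Veq Lv wv.
(* [p] dominates the negative entries of [v], so that [p + v] is nonnegative. *)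
pose p : 'cV[R]_n := const_mx `|v|.
have p0 : nonneg_mx p by move=> i j; rewrite mxE.
have pv0 : nonneg_mx (p + v).
  move=> i j; rewrite !mxE -lerBlDl sub0r.
  by have := mx_entry_le_norm v i j; rewrite ler_norml => /andP[].
set q := (w *m M *m v) 0 0.
pose N := `|P * (`|p + v| + `|p|) + 2 * Q| + 1.
have qT T : 0 < T -> T * K <= 2^-1 -> `|q| <= T * N.
  move=> T0 TK; have TV0 : 0 <= T^-1 by rewrite invr_ge0 ltW.
  have sc (z : 'cV[R]_n) : nonneg_mx z -> nonneg_mx (T^-1 *: z).
    by move=> z0 i j; rewrite mxE mulr_ge0.
  have nrm (z : 'cV[R]_n) : P * T * `|T^-1 *: z| = P * `|z|.
    by rewrite normrZ ger0_norm// mulrA mulfK// gt_eqF.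
  have ent (u : 'rV[R]_n) (z : 'cV[R]_n) : (u *m (T^-1 *: z)) 0 0 = T^-1 * (u *m z) 0 0.
    by rewrite -scalemxAr mxE.
  have [l1 u1] := VE _ (sc _ pv0) T (ltW T0) TK.
  have [l2 u2] := VE _ (sc _ p0) T (ltW T0) TK.
  have eqV : V (T^-1 *: (p + v)) T = V (T^-1 *: p) T.
    apply: Veq => //; [exact: sc|exact: sc| |exact: ltW].
    by rewrite -!scalemxAr mulmxDr Lv addr0.
  rewrite eqV in l1 u1.
  have := le_trans l1 u2; have := le_trans l2 u1; rewrite !lee_fin !nrm !ent.
  have -> : (w *m (p + v)) 0 0 = (w *m p) 0 0 by rewrite mulmxDr wv addr0.
  have -> : (w *m M *m (p + v)) 0 0 = (w *m M *m p) 0 0 + q.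
    by rewrite mulmxDr mxE.
  rewrite !(mulrA T) divff ?gt_eqF// !mul1r => h1 h2.
  have hN : T * (P * (`|p + v| + `|p|) + 2 * Q) <= T * N.
    by rewrite ler_wpM2l ?(ltW T0)// (le_trans (ler_norm _))// lerDl.
  rewrite ler_norml; apply/andP; split; lra.
apply/eqP; apply: contraT => q0; have {}q0 : 0 < `|q| by rewrite normr_gt0.
have N0 : 0 < N by rewrite ltr_wpDl.
pose T := Num.min (`|q| / (2 * N)) (2 * (K + 1))^-1.
have K1 : 0 < 2 * (K + 1) by rewrite mulr_gt0// ltr_wpDl.
have T0 : 0 < T by rewrite lt_min divr_gt0 ?mulr_gt0//= invr_gt0.
have TK : T * K <= 2^-1.
  have : T * (2 * (K + 1)) <= 1.
    by rewrite -ler_pdivlMr// div1r /T ge_min lexx orbT.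
  have := ltW T0; nra.
have : T * (2 * N) <= `|q| by rewrite -ler_pdivlMr ?mulr_gt0// /T ge_min lexx.
have := qT T T0 TK; lra.
Qed.

Definition linear_final (m n : nat) (w : 'rV[R]_n) : 'cV[R]_n * 'cV[R]_m -> R :=
  fun xu => (w *m xu.1) 0 0.

Lemma linear_final_continuous (m n : nat) (w : 'rV[R]_n) :
  continuous (@linear_final m n w).
Proof.
move=> p; apply: (@continuous_comp _ _ _ fst (fun x => (w *m x) 0 0)).
  exact: cvg_fst.
exact: mulmx_continuous.
Qed.

Lemma cost_linear_final (m n : nat) (w : 'rV[R]_n) (x : R -> 'cV[R]_n)
    (u : R -> 'cV[R]_m) (T : R) :
  cost (linear_final w) (fun=> 0) x u T = (w *m x T) 0 0.
Proof. by rewrite /cost /Rintegral integral0 addr0. Qed.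

Lemma admissible_cst (T : topologicalType) (X : set T) (p : T) :
  X p -> admissible X (fun _ : R => p).
Proof. by move=> Xp; split=> //; exact: piecewise_continuous_cst. Qed.

Section Pcs.
Context {l m n : nat}.
Variables (S : pcs R l m n) (w : 'rV[R]_n).
Hypothesis pcsS : is_pcs S.
Hypothesis w0 : nonneg_mx w.

Let K := n%:R * (`|pcs_lo S| + `|pcs_hi S|).

Lemma pcs_control_bound :
  exists beta : R, forall u, pcs_ctrl S u -> `|pcs_in S *m u| <= beta.
Proof.
have [_ [_ _ /compact_bounded[b [_ Ub]] _]] := pcsS.
exists (m%:R * (`|pcs_in S| * (b + 1))) => u Uu.
rewrite (le_trans (mx_norm_mul _ _))// !ler_wpM2l//.
by apply: Ub Uu; rewrite ltrDl.
Qed.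

(** The constants are those of the whole system [S]: the same [P] and [Q] serve
    for every trajectory, and for the degenerate intervals that contain only
    the extremal matrix. *)
Lemma pcs_expansion :
  exists P Q : R, forall (lo hi : 'M[R]_n) A u (x0 : 'cV[R]_n) x (T : R),
  mx_itv lo hi `<=` mx_itv (pcs_lo S) (pcs_hi S) ->
  admissible (mx_itv lo hi) A -> admissible (pcs_ctrl S) u ->
  is_solution A (pcs_in S) u x0 x ->
  nonneg_mx x0 -> 0 <= T -> T * K <= 2^-1 ->
  let e := T * (P * T * `|x0| + Q) in
  (w *m x0) 0 0 + T * (w *m lo *m x0) 0 0 - e <= (w *m x T) 0 0 /\
  (w *m x T) 0 0 <= (w *m x0) 0 0 + T * (w *m hi *m x0) 0 0 + e.
Proof.
have [beta Ubeta] := pcs_control_bound.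
exists (2 * n%:R * `|w| * K ^+ 2), (2 * n%:R * `|w| * beta).
move=> lo hi A u x0 x T sub [pcA Aitv] [pcu uU] xsol x00 T0 TK e.
have K0 : 0 <= K by rewrite mulr_ge0 ?addr_ge0.
have KA t : 0 <= t -> forall q (y : 'M[R]_(n, q)), `|A t *m y| <= K * `|y|.
  move=> t0 q y; rewrite (le_trans (mx_norm_mul _ _))// mulrA ler_wpM2r//.
  by rewrite ler_wpM2l// mx_itv_norm//; exact/sub/Aitv.
have -> : e = 2 * n%:R * `|w| * T * (T * K ^+ 2 * `|x0| + beta) by rewrite /e; ring.
exact: (solution_expansion pcA pcu xsol Aitv KA (fun t t0 => Ubeta _ (uU t t0))
  K0 T0 TK w0 x00).
Qed.

Lemma flow_attainable (M : 'M[R]_n) (x0 : 'cV[R]_n) (T : R) :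
  mx_itv (pcs_lo S) (pcs_hi S) M ->
  attainable_costs S (linear_final w) (fun=> 0) x0 T
    (((w *m flow M x0 T) 0 0)%:E).
Proof.
have [_ [_ _ _ U0]] := pcsS.
move=> SM; exists (fun=> M), (fun=> 0), (flow M x0).
split; [exact: admissible_cst SM|exact: admissible_cst U0|exact: flow_is_solution|].
by rewrite cost_linear_final.
Qed.

(** No trajectory does better, to first order, than the one driven by the lower
    bound of the interval, because [w] and the initial state are nonnegative. *)
Lemma Vinf_expansion :
  first_order_expansion (Vinf S (linear_final w) (fun=> 0)) w (pcs_lo S).
Proof.
have [[_ _ lohi] [_ _ _ U0]] := pcsS.
have [P [Q PQ]] := pcs_expansion.
exists K, P, Q; split; first by rewrite mulr_ge0 ?addr_ge0.
have lolo : mx_itv (pcs_lo S) (pcs_lo S) `<=` mx_itv (pcs_lo S) (pcs_hi S).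
  by move=> M [loM Mlo]; split=> // i j; exact: le_trans (Mlo i j) (lohi i j).
have lo_lo : mx_itv (pcs_lo S) (pcs_lo S) (pcs_lo S) by split=> i j.
move=> x0 x00 T T0 TK a e; split.
  apply: le_ereal_inf_tmp => _ [A [u [x [aA au xsol ->]]]].
  rewrite cost_linear_final lee_fin.
  by have [] := PQ _ _ A u x0 x T (@subset_refl _ _) aA au xsol x00 T0 TK.
apply: ge_ereal_inf; exists ((w *m flow (pcs_lo S) x0 T) 0 0)%:E.
  exact/flow_attainable/lolo.
rewrite lee_fin.
by have [] := PQ _ _ _ _ x0 _ T lolo (admissible_cst lo_lo) (admissible_cst U0)
  (flow_is_solution _ _ _) x00 T0 TK.
Qed.

Lemma Vsup_expansion :
  first_order_expansion (Vsup S (linear_final w) (fun=> 0)) w (pcs_hi S).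
Proof.
have [[_ _ lohi] [_ _ _ U0]] := pcsS.
have [P [Q PQ]] := pcs_expansion.
exists K, P, Q; split; first by rewrite mulr_ge0 ?addr_ge0.
have hihi : mx_itv (pcs_hi S) (pcs_hi S) `<=` mx_itv (pcs_lo S) (pcs_hi S).
  by move=> M [hiM Mhi]; split=> // i j; exact: le_trans (lohi i j) (hiM i j).
have hi_hi : mx_itv (pcs_hi S) (pcs_hi S) (pcs_hi S) by split=> i j.
move=> x0 x00 T T0 TK a e; split.
  apply: le_ereal_sup_tmp; exists ((w *m flow (pcs_hi S) x0 T) 0 0)%:E.
    exact/flow_attainable/hihi.
  rewrite lee_fin.
  by have [] := PQ _ _ _ _ x0 _ T hihi (admissible_cst hi_hi) (admissible_cst U0)
    (flow_is_solution _ _ _) x00 T0 TK.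
apply: ge_ereal_sup => _ [A [u [x [aA au xsol ->]]]].
rewrite cost_linear_final lee_fin.
by have [] := PQ _ _ A u x0 x T (@subset_refl _ _) aA au xsol x00 T0 TK.
Qed.

End Pcs.
End Values.

(** * From invariant values to invariant row spaces *)

Section RowSpace.
Context {R : realType}.

Lemma submx_of_ker (F : fieldType) (p k n : nat) (L : 'M[F]_(k, n))
    (M : 'M[F]_(p, n)) :
  (forall v : 'cV[F]_n, L *m v = 0 -> M *m v = 0) -> (M <= L)%MS.
Proof.
move=> kerLM; rewrite submxE; apply/eqP/matrixP => i j.
have /colP/(_ i) : M *m col j (cokermx L) = 0.
  by apply: kerLM; rewrite colE mulmxA mulmx_coker mul0mx.
by rewrite colE mulmxA -colE !mxE.
Qed.

Lemma submx_of_expansion (k n : nat) (L : 'M[R]_(k, n)) (M : 'M[R]_n)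
    (V : 'I_k -> 'cV[R]_n -> R -> \bar R) :
  (forall r, first_order_expansion (V r) (row r L) M) ->
  (forall r x0 x0', nonneg_mx x0 -> nonneg_mx x0' -> L *m x0 = L *m x0' ->
     forall T, 0 <= T -> V r x0 T = V r x0' T) ->
  (L *m M <= L)%MS.
Proof.
move=> VE Veq; apply: submx_of_ker => v Lv; apply/colP => r.
have wv : row r L *m v = 0 by rewrite -row_mul Lv row0.
by have := first_order_kernel (VE r) (Veq r) Lv wv; rewrite -!row_mul !mxE.
Qed.

(** The values of the reduced system mention the initial state [x0] only
    through [L *m x0]. *)
Lemma preserved_values_eq (l m n k : nat) (S : pcs R l m n) (L : 'M[R]_(k, n))
    Phi Psi (x0 x0' : 'cV[R]_n) (T : R) :
  preserves_costs L S ->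
  continuous Phi -> continuous Psi ->
  final_invariant L Phi -> running_invariant L Psi ->
  nonneg_mx x0 -> nonneg_mx x0' -> L *m x0 = L *m x0' -> 0 <= T ->
  Vinf S Phi Psi x0 T = Vinf S Phi Psi x0' T /\
  Vsup S Phi Psi x0 T = Vsup S Phi Psi x0' T.
Proof.
move=> presL cPhi cPsi iPhi iPsi x00 x00' eqL T0.
have [-> ->] := presL x0 x00 T T0 Phi Psi cPhi cPsi iPhi iPsi.
have [-> ->] := presL x0' x00' T T0 Phi Psi cPhi cPsi iPhi iPsi.
by rewrite eqL.
Qed.

End RowSpace.

Theorem theorem2 (R : realType) (l m n k : nat) (S : pcs R l m n)
    (L : 'M[R]_(k, n)) :
  is_pcs S ->
  proper_mx L ->
  (pcs_out S <= L)%MS ->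
  preserves_costs L S ->
  constrained_proper_positive_lumping L S.
Proof.
move=> pcsS properL OL presL.
have [L0 rkL _] := properL.
have w0 r : nonneg_mx (row r L) by move=> i j; rewrite mxE.
pose Phi r := @linear_final R m n (row r L).
pose Psi := fun _ : R * 'cV[R]_n * 'cV[R]_m => 0 : R.
have values r x0 x0' : nonneg_mx x0 -> nonneg_mx x0' -> L *m x0 = L *m x0' ->
    forall T, 0 <= T ->
    Vinf S (Phi r) Psi x0 T = Vinf S (Phi r) Psi x0' T /\
    Vsup S (Phi r) Psi x0 T = Vsup S (Phi r) Psi x0' T.
  move=> x00 x00' eqL T T0; apply: preserved_values_eq presL _ _ _ _ x00 x00' eqL T0.
  - exact: linear_final_continuous.
  - exact: cst_continuous.
  - by move=> x x' u Lxx'; rewrite /Phi /linear_final /= -!row_mul Lxx'.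
  - by [].
split=> //; split=> //.
- apply: (submx_of_expansion (fun r => Vinf_expansion pcsS (w0 r))).
  by move=> r x0 x0' x00 x00' eqL T T0; have [] := values r x0 x0' x00 x00' eqL T T0.
- apply: (submx_of_expansion (fun r => Vsup_expansion pcsS (w0 r))).
  by move=> r x0 x0' x00 x00' eqL T T0; have [] := values r x0 x0' x00 x00' eqL T T0.
Qed.
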